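(* Fix $\mu_0$ and $\mu_1$. For each $n$, consider the $n$-agent repeated voting process associated with $\mu_0,\mu_1$. Then there exist constants $C=C(\mu_0,\mu_1)>0$ and $n_0=n_0(\mu_0,\mu_1)$, depending only on $\mu_0$ and $\mu_1$, such that for all $n>n_0$ $$\mathbb{P}\big[\forall i\in[n]:\ V_i(2)=S\big]\ >\ 1-e^{-Cn}.$$
   Context: Signals. $\mu_0$ and $\mu_1$ are probability measures on a measurable space $(\Omega,\mathcal{O})$ such that: (1) $\mu_0$ and $\mu_1$ are mutually absolutely continuous, so that the Radon-Nikodym derivative $\frac{d\mu_1}{d\mu_0}(\omega)$ exists and is (taken to be) non-zero for all $\omega\in\Omega$; (2) if $W$ is distributed according to $\frac12\mu_0+\frac12\mu_1$ and $X=\log\frac{d\mu_1}{d\mu_0}(W)$, then the distribution of $X$ is non-atomic (no point has positive mass). Probability space. $[n]=\{1,\dots,n\}$ is the set of agents. Let $\delta_0,\delta_1$ be the point masses at $0$ and $1$ on $\{0,1\}$. The random variables $S\in\{0,1\}$ (the state of the world) and $(W_1,\dots,W_n)\in\Omega^n$ (the private signals, $W_i$ being that of agent $i$) have joint law $\mathbb{P}=\frac12\,\delta_0\otimes\mu_0^{\otimes n}+\frac12\,\delta_1\otimes\mu_1^{\otimes n}$ (which depends on $n$). That is, $S$ is uniform on $\{0,1\}$ and, conditioned on $S$, the $W_i$ are i.i.d. with law $\mu_S$. Votes. For $t\in\{1,2,\dots\}$ and $i\in[n]$, the vote $V_i(t)$ is defined recursively in $t$ by $V_i(t)=1$ if $\mathbb{P}[S=1\mid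 W_i,\bar V^{t-1}]>1/2$ and $V_i(t)=0$ otherwise, where $\bar V^{t}=\{V_j(t'): j\in[n],\ 1\le t'\le t\}$ is the collection of all agents' votes up to time $t$ ($\bar V^0$ is empty). Conditional probabilities are defined up to $\mathbb{P}$-null sets. *)

(* Defs.v *)
From HB Require Import structures.
From mathcomp Require Import all_boot all_order all_algebra.
From mathcomp Require Import all_classical all_reals all_analysis.

Set Implicit Arguments.
Unset Strict Implicit.
Unset Printing Implicit Defensive.

Import Order.TTheory GRing.Theory Num.Theory.
Import numFieldNormedType.Exports.

Local Open Scope classical_set_scope.
Local Open Scope ring_scope.
Local Open Scope charge_scope.

Section fair_mixture.
Context d (T : measurableType d) (R : realType).
Variables P0 P1 : probability T R.

Definition fair_mixture : set T -> \bar R :=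
  measure_add (mscale (2^-1)%:nng P0) (mscale (2^-1)%:nng P1).

HB.instance Definition _ := Measure.on fair_mixture.

Lemma fair_mixtureE A :
  fair_mixture A = ((2^-1)%:E * P0 A + (2^-1)%:E * P1 A)%E.
Proof. by rewrite /fair_mixture measure_addE. Qed.

Let fair_mixture_setT : fair_mixture [set: T] = 1%E.
Proof.
by rewrite fair_mixtureE !probability_setT !mule1 -EFinD [X in _ = X%:E](splitr 1) div1r.
Qed.

HB.instance Definition _ :=
  Measure_isProbability.Build _ _ _ fair_mixture fair_mixture_setT.
End fair_mixture.

Section iid.
Context d (T : measurableType d) (R : realType).

Definition tcons n (x : T * n.-tuple T) : n.+1.-tuple T :=
  [tuple of x.1 :: x.2].

Lemma measurable_tcons n : measurable_fun [set: T * n.-tuple T] (@tcons n).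
Proof. exact: measurable_cons. Qed.

HB.instance Definition _ n :=
  isMeasurableFun.Build _ _ _ _ (@tcons n) (@measurable_tcons n).

(* The n-fold product of mu, characterised on boxes by iid_law_box. *)
Fixpoint iid_law (mu : probability T R) n : probability (n.-tuple T) R :=
  match n with
  | 0 => \d_([tuple] : 0.-tuple T)
  | n'.+1 => distribution (mu \x iid_law mu n')%E (@tcons n')
  end.

Lemma iid_law_box (mu : probability T R) n (A : 'I_n -> set T) :
  (forall i, measurable (A i)) ->
  iid_law mu n [set x | forall i, A i (tnth x i)] = (\prod_(i < n) mu (A i))%E.
Proof.
have mbox k (B : 'I_k -> set T) : (forall i, measurable (B i)) ->
    measurable [set x : k.-tuple T | forall i, B i (tnth x i)].
  move=> mB; rewrite (_ : [set _ | _] =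
      \bigcap_(i in [set: 'I_k]) ((@tnth _ T ^~ i) @^-1` B i)).
    apply: fin_bigcap_measurable => // i _.
    by rewrite -[X in measurable X]setTI; exact: measurable_tnth.
  by apply/seteqP; split => [x h i _|x h i]; [exact: h|exact: (h i I)].
elim: n A => [|n IH] A mA.
  by rewrite big_ord0 /= diracE mem_set//=; case.
rewrite big_ord_recl -IH//= /distribution /pushforward.
rewrite -product_measure1E//; last exact: (mbox _ (fun i => A (lift ord0 i))).
congr (product_measure1 _ _ _); apply/seteqP; split => -[a x] /=.
  move=> h; split; first exact: (h ord0).
  by move=> i; have := h (lift ord0 i); rewrite tnthS.
move=> [h0 h] i; case: (unliftP ord0 i) => [j ->|->//].
by rewrite tnthS.
Qed.
End iid.

(* p is a version of the conditional probability of A given the sigma-algebra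
   <<s G>>. *)
Definition is_cond_prob d (T : measurableType d) (R : realType)
    (P : probability T R) (G : set (set T)) (A : set T) (p : T -> R) : Prop :=
  [/\ forall B, measurable B -> <<s G>> (p @^-1` B),
      P.-integrable [set: T] (EFin \o p) &
      forall B, <<s G>> B -> (\int[P]_(x in B) (p x)%:E)%E = P (A `&` B)].

Definition nonatomic (R : realType) (m : set R -> \bar R) : Prop :=
  forall x, m [set x] = 0%E.

Section voting.
Context d (Omega : measurableType d) (R : realType).
Variables mu0 mu1 : probability Omega R.

(* The derivative 'd _ '/d _ is a particular real-valued version; since
   ln r = 0 for r <= 0, this is the logarithm of the version of the derivative
   that is reset to 1 on the null set where it is not positive. *)
Definition log_likelihood_ratio (w : Omega) : R :=
  ln (fine (('d (charge_of_finite_measure mu1) '/d mu0) w)).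

Record signal_pair : Prop := SignalPair {
  signal_dominates01 : mu0 `<< mu1;
  signal_dominates10 : mu1 `<< mu0;
  signal_nonatomic :
    nonatomic (pushforward (fair_mixture mu0 mu1) log_likelihood_ratio) }.

Variable n : nat.

Definition joint_law : probability (bool * n.-tuple Omega)%type R :=
  fair_mixture (\d_false \x iid_law mu0 n)%E (\d_true \x iid_law mu1 n)%E.

Definition state (x : bool * n.-tuple Omega) : bool := x.1.

Definition signal (i : 'I_n) (x : bool * n.-tuple Omega) : Omega := tnth x.2 i.

(* Generators of the sigma-algebra of (W_i, V_j(t') : j, 1 <= t' < t), i.e. of
   what agent i knows when casting the vote V_i(t). *)
Definition information (V : 'I_n -> nat -> bool * n.-tuple Omega -> bool)
    (i : 'I_n) (t : nat) : set (set (bool * n.-tuple Omega)) :=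
  preimage_set_system setT (signal i) measurable `|`
  \bigcup_(jt in [set jt : 'I_n * nat | (1 <= jt.2 < t)%N])
    preimage_set_system setT (V jt.1 jt.2) measurable.

(* V is obtained by the recursive voting rule, for some choice of versions of
   the conditional probabilities. Votes are cast at times t >= 1; V i 0 is
   unused. *)
Definition voting_process
    (V : 'I_n -> nat -> bool * n.-tuple Omega -> bool) : Prop :=
  forall (i : 'I_n) (t : nat), (1 <= t)%N ->
    exists2 p, is_cond_prob joint_law (information V i t) [set x | state x] p &
      forall x, V i t x = (2^-1 < p x).
End voting.

(* Main.v *)
Require Import Defs.
From mathcomp Require Import all_boot all_order all_algebra.
From mathcomp Require Import ring lra.
From mathcomp Require Import all_classical all_reals all_analysis.
From mathcomp Require Import measurable_realfun.
Import Order.TTheory GRing.Theory Num.Theory.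
Import numFieldNormedType.Exports.
Local Open Scope classical_set_scope.
Local Open Scope ring_scope.
Local Open Scope charge_scope.

(** The proof never computes the second votes. It bounds their error by that of a
simple common estimator, through two uses of the optimality of the Bayes rule
([bayes_decision_optimal]).

Since the log-likelihood ratio has no atom at 0, the signal laws differ, so some
event [A] satisfies [delta := mu1 A - mu0 A > 0] ([exists_separating_event]). A
first vote is a test of a single signal, [V i 1 x = (signal i x \in D i)], and
it is optimal among such tests, in particular compared with [A]; hence
[mu1 (D i) - mu0 (D i) >= delta] for every agent ([first_vote_separates]).

Consequently the number of first votes equal to 1 has conditional means, given
the two states, that are at least [n * delta] apart. As the votes are independent
given the state, comparing their number with the midpoint of the two means
recovers the state with an error of at most [exp (- delta ^ 2 n / 32)]
([threshold_error], by the Chernoff bounds [chernoff_count] and [count_tail]).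

All the first votes are known to every agent at time 2, so this estimator is one
of the decisions available to agent [i], and [V i 2], being a Bayes decision,
errs no more often. A union bound over the [n] agents costs a factor [n], which
is absorbed by half of the exponential rate for large [n]. *)

Set Implicit Arguments.
Unset Strict Implicit.

(** * Measurability of counting events and of the model's variables *)

Lemma measurable_count_ge (d : measure_display) (T : measurableType d)
    (R : realType) (n : nat) (B : 'I_n -> set T) (t : R) :
  (forall i, measurable (B i)) ->
  measurable [set x : T | t <= \sum_(i < n) \1_(B i) x].
Proof.
move=> mB; rewrite -[X in measurable X]setTI.
apply: measurable_fun_le => //; apply: measurable_sum => i.
exact: measurable_indic.
Qed.

(** The space is arbitrary so that it can be the sample space equipped with the
sub-sigma-algebra of what an agent knows. *)
Lemma measurable_count_gt (d : measure_display) (T : measurableType d)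
    (R : realType) (n : nat) (B : 'I_n -> set T) (t : R) :
  (forall i, measurable (B i)) ->
  measurable [set x : T | t < \sum_(i < n) \1_(B i) x].
Proof.
move=> mB.
rewrite (_ : [set _ | _] = ~` (setT `&` [set x | \sum_(i < n) \1_(B i) x <= t])).
  apply: measurableC; apply: measurable_fun_le => //.
  by apply: measurable_sum => i; exact: measurable_indic.
by rewrite setTI; apply/seteqP; split => x /=; rewrite ltNge => /negP.
Qed.

Lemma measurable_coordinate (d : measure_display) (T : measurableType d)
    (n : nat) (i : 'I_n) (A : set T) :
  measurable A -> measurable [set x : n.-tuple T | A (tnth x i)].
Proof.
by move=> mA; rewrite -[X in measurable X]setTI; exact: measurable_tnth.
Qed.

Lemma measurable_disagreement (d : measure_display) (T : measurableType d)
    (u v : T -> bool) :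
  measurable [set x | u x] -> measurable [set x | v x] ->
  measurable [set x | u x != v x].
Proof.
move=> mu mv.
rewrite (_ : [set _ | _] = ([set x | u x] `&` ~` [set x | v x]) `|`
                           (~` [set x | u x] `&` [set x | v x])).
  by apply: measurableU; apply: measurableI => //; exact: measurableC.
by apply/seteqP; split => x /=; case: (u x) (v x) => [] [] /=; intuition.
Qed.

Lemma measurable_state (d : measure_display) (Omega : measurableType d) n :
  measurable [set x : bool * n.-tuple Omega | state x].
Proof.
rewrite (_ : [set _ | _] = setT `&` fst @^-1` [set true]).
  exact: measurable_fst.
by apply/seteqP; split => x //= [].
Qed.

Lemma measurable_signal (d : measure_display) (Omega : measurableType d) n
    (i : 'I_n) : measurable_fun setT (@signal d Omega n i).
Proof. exact: (measurableT_comp (measurable_tnth i) measurable_snd). Qed.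

(** * Concentration for independent events *)

(** The exponential Markov inequality, whose right-hand side is the product of the
moment generating functions of the indicators. Both the product formula for the
expectation and Markov's inequality come out of a single induction on [n], in
which only the integral of one indicator is ever computed. *)
Lemma chernoff_count (d : measure_display) (T : measurableType d)
    (R : realType) (mu : probability T R) (n : nat) (A : 'I_n -> set T)
    (l t : R) :
  (forall i, measurable (A i)) -> 0 <= l ->
  (iid_law mu n [set x | (t <= \sum_(i < n) \1_(A i) (tnth x i))%R] <=
   (expR (- (l * t)) * \prod_(i < n) (1 + (expR l - 1) * fine (mu (A i))))%:E)%E.
Proof.
move=> mA l0.
have el1 : 0 <= expR l - 1 by rewrite subr_ge0 -expR0 ler_expR.
(* the first coordinate is peeled off, since the n.+1-fold law is the image of
   a product measure, computed by integrating sections *)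
elim: n A t mA => [|n IH] A t mA.
  rewrite big_ord0 mulr1 /= diracE lee_fin.
  have [/set_mem/=|_] := boolP (_ \in _); last exact: expR_ge0.
  rewrite big_ord0 => t0.
  by rewrite -expR0 ler_expR oppr_ge0 mulr_ge0_le0.
set E := [set x | _].
pose A' (i : 'I_n) := A (lift ord0 i).
have mA' i : measurable (A' i) by exact: mA.
pose K := \prod_(i < n) (1 + (expR l - 1) * fine (mu (A' i))).
have K0 : 0 <= K.
  by apply: prodr_ge0 => i _; rewrite addr_ge0// mulr_ge0// fine_ge0.
have mE : measurable (@tcons _ T n @^-1` E).
  rewrite -[X in measurable X]setTI; apply: measurable_tcons => //.
  apply: (@measurable_count_ge _ _ _ _ (fun i => [set x | A i (tnth x i)])) => i.
  exact: measurable_coordinate.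
have xE a : xsection (@tcons _ T n @^-1` E) a =
    [set x | t - \1_(A ord0) a <= \sum_(i < n) \1_(A' i) (tnth x i)].
  apply/seteqP; split => x.
    rewrite /xsection/= inE /E/= big_ord_recl/= tnth0 lerBlDl.
    by under eq_bigr do rewrite tnthS.
  rewrite /xsection/= inE /E/= big_ord_recl/= tnth0 lerBlDl.
  by under [in X in _ -> X]eq_bigr do rewrite tnthS.
pose c := expR (- (l * t)) * K.
have c0 : 0 <= c by rewrite mulr_ge0 ?expR_ge0.
have -> : iid_law mu n.+1 E =
    (\int[mu]_a iid_law mu n (xsection (@tcons _ T n @^-1` E) a))%E by [].
(* expR (l * \1_A a) = 1 + (expR l - 1) * \1_A a *)
apply: (@le_trans _ _
    (\int[mu]_a (c%:E + (c * (expR l - 1))%:E * (\1_(A ord0) a)%:E))%E).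
  apply: ge0_le_integral => //.
  - exact: measurable_fun_xsection.
  - apply: emeasurable_funD => //.
    apply: emeasurable_funM => //.
    exact/measurable_EFinP/measurable_indic.
  - move=> a _; rewrite xE; apply: (le_trans (IH A' _ mA')).
    rewrite -EFinM -EFinD lee_fin -/K le_eqVlt; apply/orP; left; apply/eqP.
    rewrite mulrBr opprB addrC expRD /c indicE.
    by case: (a \in A ord0); rewrite ?mulr1 ?mulr0 ?expR0; ring.
rewrite ge0_integralD//; last 2 first.
- move=> a _; rewrite -EFinM lee_fin mulr_ge0//; exact: mulr_ge0.
- apply: emeasurable_funM => //.
  exact/measurable_EFinP/measurable_indic.
rewrite ge0_integralZl//; last 2 first.
- exact/measurable_EFinP/measurable_indic.
- by rewrite lee_fin; exact: mulr_ge0.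
rewrite integral_cst// [X in (_ * X + _)%E](probability_setT mu) mule1.
rewrite integral_indic// setIT.
rewrite big_ord_recl -/K.
rewrite -[X in (_ + _ * X <= _)%E](fineK (fin_num_measure mu _ (mA ord0))).
by rewrite -EFinM -EFinD lee_fin /c le_eqVlt; apply/orP; left; apply/eqP => /=; ring.
Qed.

(** Follows from [expR (- l) >= 1 - l] by inverting; the factor 2 is the price of
bounding [(1 - l)^-1] by a quadratic polynomial. *)
Lemma expR_sub1_le (R : realType) (l : R) :
  0 <= l <= 2^-1 -> expR l - 1 <= l + 2 * l ^+ 2.
Proof.
move=> /andP[l0 l2].
have h : expR l * (1 - l) <= 1.
  rewrite -[leRHS](expRxMexpNx_1 l) ler_pM2l ?expR_gt0//.
  exact: expR_ge1Dx.
have h1 : expR l * (1 - l) <= (1 + l + 2 * l ^+ 2) * (1 - l).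
  apply: (le_trans h); nra.
by move: h1; rewrite ler_pM2r; lra.
Qed.

(** A Hoeffding bound, uniform in the probabilities [mu (A i)]: this uniformity
lets the events differ from one index to the next. *)
Lemma count_tail (d : measure_display) (T : measurableType d)
    (R : realType) (mu : probability T R) (n : nat) (A : 'I_n -> set T)
    (s t : R) :
  (forall i, measurable (A i)) -> 0 <= s <= 1 ->
  n%:R * s + \sum_(i < n) fine (mu (A i)) <= t ->
  (iid_law mu n [set x | (t <= \sum_(i < n) \1_(A i) (tnth x i))%R] <=
   (expR (- (s ^+ 2 / 8 * n%:R)))%:E)%E.
Proof.
move=> mA /andP[s0 s1] ht.
(* l = s / 4 minimises the final exponent - l * s + 2 * l ^+ 2 *)
have l0 : 0 <= s / 4 by lra.
apply: (le_trans (chernoff_count mu t mA l0)).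
set l := s / 4; rewrite lee_fin.
have q01 i : 0 <= fine (mu (A i)) <= 1.
  rewrite fine_ge0//=.
  rewrite -lee_fin fineK ?fin_num_measure//; exact: probability_le1.
apply: (@le_trans _ _ (expR (- (l * t)) *
    \prod_(i < n) expR (l * fine (mu (A i)) + 2 * l ^+ 2))).
  rewrite ler_pM2l ?expR_gt0//; apply: ler_prod => i _.
  have e1 : expR l - 1 <= l + 2 * l ^+ 2.
    by apply: expR_sub1_le; rewrite /l; lra.
  have e0 : 0 <= expR l - 1 by rewrite subr_ge0 -expR0 ler_expR.
  have /andP[qi0 qi1] := q01 i.
  rewrite addr_ge0 ?mulr_ge0//=.
  apply: le_trans (expR_ge1Dx _).
  rewrite lerD2l; apply: (@le_trans _ _ ((l + 2 * l ^+ 2) * fine (mu (A i)))).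
    exact: ler_wpM2r.
  rewrite mulrDl lerD2l ler_piMr// mulr_ge0// sqr_ge0//.
rewrite -expR_sum -expRD ler_expR big_split/= -mulr_sumr sumr_const card_ord.
rewrite -mulr_natr.
have : l * (n%:R * s + \sum_(i < n) fine (mu (A i))) <= l * t by exact: ler_wpM2l.
rewrite /l; set S := \sum_(i < n) _; set N : R := n%:R => h; lra.
Qed.

(** * Optimality of the Bayes decision *)

Lemma cond_prob_gt_half_measurable (d : measure_display) (T : measurableType d)
    (R : realType) (P : probability T R) (G : set (set T)) (A : set T)
    (p : T -> R) (v : T -> bool) :
  is_cond_prob P G A p -> (forall x, v x = (2^-1 < p x)) ->
  <<s G>> [set x | v x].
Proof.
move=> [mp _ _] vE; rewrite (_ : [set _ | _] = p @^-1` `]2^-1, +oo[).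
  by apply: mp; exact: measurable_itv.
by apply/seteqP; split => x/=; rewrite vE in_itv/= andbT.
Qed.

(** The Bayes rule has the smallest error probability among the decisions based
on the same information: where [p > 1/2] the event [s] carries at least half of
the mass of every [G]-event, and at most half elsewhere, so replacing [u] by [v]
on the two [G]-events where they differ can only reduce the error. *)
Lemma bayes_decision_optimal (d : measure_display) (T : measurableType d)
    (R : realType) (P : probability T R) (G : set (set T)) (s v u : T -> bool)
    (p : T -> R) :
  <<s G>> `<=` measurable -> measurable [set x | s x] ->
  is_cond_prob P G [set x | s x] p -> (forall x, v x = (2^-1 < p x)) ->
  <<s G>> [set x | u x] ->
  (P [set x | v x != s x] <= P [set x | u x != s x])%E.
Proof.
move=> sG mS cp vE mu; have mv := cond_prob_gt_half_measurable cp vE.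
have [mp ip intp] := cp.
pose X : measurableType _ := g_sigma_algebraType G.
pose S := [set x | s x].
pose E1 := [set x | v x] `&` ~` [set x | u x].
pose E2 := [set x | u x] `&` ~` [set x | v x].
(* v and u differ on E1 and E2 only; F is the part of the error common to both *)
pose F := ([set x | v x] `&` [set x | u x] `&` ~` S) `|`
          (~` [set x | v x] `&` ~` [set x | u x] `&` S).
have GE1 : <<s G>> E1 by apply: (@measurableI _ X) => //; exact: (@measurableC _ X).
have GE2 : <<s G>> E2 by apply: (@measurableI _ X) => //; exact: (@measurableC _ X).
have [mE1 mE2 mv' mu'] := And4 (sG _ GE1) (sG _ GE2) (sG _ mv) (sG _ mu).
have mF : measurable F.
  by apply: measurableU; repeat apply: measurableI => //; exact: measurableC.
have half E : measurable E -> ((2^-1)%:E * P E = \int[P]_(x in E) (2^-1)%:E)%E.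
  by move=> mE; rewrite integral_cst.
have ipE E : measurable E -> P.-integrable E (EFin \o p).
  by move=> mE; apply: integrableS ip.
have icE E : measurable E -> P.-integrable E (EFin \o cst 2^-1).
  by move=> mE; exact: finite_measure_integrable_cst.
have PE E : measurable E -> P E = (P (S `&` E) + P (~` S `&` E))%E.
  move=> mE; rewrite -measureU//.
  - by rewrite -setIUl setUv setTI.
  - exact: measurableI.
  - by apply: measurableI => //; exact: measurableC.
  - by rewrite setIACA setICr set0I.
have h1 : (P (~` S `&` E1) <= P (S `&` E1))%E.
  have : ((2^-1)%:E * P E1 <= P (S `&` E1))%E.
    rewrite half// -intp//; apply: le_integral => //.
    + exact: (icE E1).
    + exact: ipE.
    + by move=> x /set_mem[]/=; rewrite vE lee_fin => /ltW.
  rewrite PE// -(fineK (fin_num_measure P _ (measurableI _ _ mS mE1))).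
  rewrite -(fineK (fin_num_measure P _ (measurableI _ _ (measurableC mS) mE1))).
  rewrite -EFinD -EFinM !lee_fin; lra.
have h2 : (P (S `&` E2) <= P (~` S `&` E2))%E.
  have : (P (S `&` E2) <= (2^-1)%:E * P E2)%E.
    rewrite half// -intp//; apply: le_integral => //.
    + exact: ipE.
    + exact: (icE E2).
    + by move=> x /set_mem[_]/= /negP; rewrite vE lee_fin -leNgt.
  rewrite (PE E2)// -(fineK (fin_num_measure P _ (measurableI _ _ mS mE2))).
  rewrite -(fineK (fin_num_measure P _ (measurableI _ _ (measurableC mS) mE2))).
  rewrite -EFinD -EFinM !lee_fin; lra.
have split3 A B : measurable A -> measurable B ->
    P (F `|` (A `&` E1 `|` B `&` E2)) = (P F + (P (A `&` E1) + P (B `&` E2)))%E.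
  move=> mA mB; have mAE1 := measurableI _ _ mA mE1.
  have mBE2 := measurableI _ _ mB mE2.
  rewrite measureU//; last 2 first.
  - exact: measurableU.
  - apply/seteqP; split => // x [] [[[]]|[[]]] /=.
    + by move=> ? ? _ [[_ []]|[_ []]].
    + by move=> ? ? _ [[_ []]|[_ []]].
  congr (_ + _)%E; rewrite measureU//.
  by apply/seteqP; split => // x [] [_ []]/= ? ? [_ []].
have -> : [set x | v x != s x] = F `|` ((~` S `&` E1) `|` (S `&` E2)).
  apply/seteqP; split => x; rewrite /F /E1 /E2 /S /=;
    case: (v x) (u x) (s x) => [] [] [] /=; intuition.
have -> : [set x | u x != s x] = F `|` ((S `&` E1) `|` (~` S `&` E2)).
  apply/seteqP; split => x; rewrite /F /E1 /E2 /S /=;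
    case: (v x) (u x) (s x) => [] [] [] /=; intuition.
rewrite !split3//; try exact: measurableC.
by apply: leeD => //; exact: leeD.
Qed.

(** * The two signal laws and the joint law *)

(** Were there no such event, the two measures would coincide, so that the
log-likelihood ratio would vanish almost everywhere and have an atom at 0. *)
Lemma exists_separating_event (d : measure_display) (Omega : measurableType d)
    (R : realType) (mu0 mu1 : probability Omega R) :
  signal_pair mu0 mu1 -> exists2 A, measurable A & (mu0 A < mu1 A)%E.
Proof.
move=> [_ mu10 nonat]; apply: contrapT => noA.
(* applied to complements, le10 forces mu1 = mu0 *)
have le10 A : measurable A -> (mu1 A <= mu0 A)%E.
  by move=> mA; rewrite leNgt; apply/negP => ltA; apply: noA; exists A.
have mu01 A : measurable A -> mu1 A = mu0 A.
  move=> mA; apply/eqP; rewrite eq_le le10//=.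
  have := le10 _ (measurableC mA); rewrite !probability_setC//.
  rewrite -(fineK (fin_num_measure mu0 _ mA)) -(fineK (fin_num_measure mu1 _ mA)).
  by rewrite -!EFinB !lee_fin; lra.
pose L := 'd (charge_of_finite_measure mu1) '/d mu0.
have iL : mu0.-integrable setT L by exact: Radon_Nikodym_integrable.
have L1 : ae_eq mu0 setT L (cst 1%E).
  apply: integral_ae_eq => // E _ mE.
  by rewrite -Radon_Nikodym_integral// integral_cst// mul1e; exact: mu01.
pose Z := log_likelihood_ratio mu0 mu1 @^-1` [set 0].
have mZ : measurable Z.
  have mllr : measurable_fun setT (log_likelihood_ratio mu0 mu1).
    rewrite (_ : log_likelihood_ratio mu0 mu1 = @ln R \o (fine \o L))//.
    apply: measurableT_comp => //; apply: measurableT_comp => //.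
    by case/integrableP: iL.
  by rewrite -[X in measurable X]setTI; exact: mllr.
have := nonat 0; rewrite /pushforward fair_mixtureE -/Z => Z0.
have [N [mN N0 subN]] := L1.
have : (1 <= mu0 Z)%E.
  rewrite -[leLHS]sube0 -N0 -probability_setC//.
  apply: le_measure; rewrite ?inE//; first exact: measurableC.
  move=> x Nx; rewrite /Z/= /log_likelihood_ratio.
  have -> : 'd (charge_of_finite_measure mu1) '/d mu0 x = 1%E.
    by apply: contrapT => h; apply: Nx; apply: subN => /= /(_ I).
  by rewrite /= ln1.
move: Z0; rewrite -(fineK (fin_num_measure mu0 _ mZ)).
rewrite -(fineK (fin_num_measure mu1 _ mZ)) -!EFinM -EFinD lee_fin => -[].
have : 0 <= fine (mu1 Z) by exact: fine_ge0.
lra.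
Qed.

Lemma iid_law_marginal (d : measure_display) (T : measurableType d)
    (R : realType) (mu : probability T R) (n : nat) (i : 'I_n) (A : set T) :
  measurable A -> iid_law mu n [set x | A (tnth x i)] = mu A.
Proof.
move=> mA; pose B j := if j == i then A else setT.
have -> : [set x : n.-tuple T | A (tnth x i)] = [set x | forall j, B j (tnth x j)].
  apply/seteqP; split => x /= Ax; last by have := Ax i; rewrite /B eqxx.
  by move=> j; rewrite /B; case: eqP => [->|].
rewrite iid_law_box; last by move=> j; rewrite /B; case: ifP.
rewrite (bigD1 i)//= big1 ?mule1 /B ?eqxx// => j /negbTE ->.
exact: probability_setT.
Qed.

Lemma joint_lawE (d : measure_display) (Omega : measurableType d)
    (R : realType) (mu0 mu1 : probability Omega R) (n : nat)
    (A : set (bool * n.-tuple Omega)) :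
  measurable A ->
  joint_law mu0 mu1 n A =
  ((2^-1)%:E * iid_law mu0 n [set w | A (false, w)] +
   (2^-1)%:E * iid_law mu1 n [set w | A (true, w)])%E.
Proof.
move=> mA.
have dirac_section (mu : probability Omega R) b :
    ((\d_b \x iid_law mu n) A)%E = iid_law mu n [set w | A (b, w)].
  rewrite /= /product_measure1 integral_dirac//.
  by rewrite diracT mul1e /= xsectionE.
by apply: (eq_trans (fair_mixtureE _ _ A)); congr (_ * _ + _ * _)%E; exact: dirac_section.
Qed.

Lemma signal_error (d : measure_display) (Omega : measurableType d)
    (R : realType) (mu0 mu1 : probability Omega R) (n : nat) (i : 'I_n)
    (D : set Omega) :
  measurable D ->
  joint_law mu0 mu1 n [set x | (signal i x \in D) != state x] =
  ((2^-1)%:E * mu0 D + (2^-1)%:E * mu1 (~` D))%E.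
Proof.
move=> mD; rewrite joint_lawE; last first.
  apply: measurable_disagreement; last exact: measurable_state.
  rewrite (_ : [set _ | _] = setT `&` signal i @^-1` D).
    exact: measurable_signal.
  by apply/seteqP; split => x /=; rewrite in_setE => //; case.
rewrite -(iid_law_marginal mu0 i mD).
rewrite -(iid_law_marginal mu1 i (measurableC mD)).
congr (_ * iid_law mu0 n _ + _ * iid_law mu1 n _)%E.
- by apply/seteqP; split => x; rewrite /= /signal /= eqbF_neg negbK in_setE.
- apply/seteqP; split => x; rewrite /= /signal /= eqb_id.
    by move=> /negP; rewrite in_setE.
  by move=> h; apply/negP; rewrite in_setE.
Qed.

(** * Votes *)

(** A first vote depends on the private signal alone, so it is a test of the
form [signal i x \in D]; by optimality of the Bayes rule its error, which is
[(1 - (mu1 D - mu0 D)) / 2], is at most that of every test [B]. *)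
Lemma first_vote_separates (d : measure_display) (Omega : measurableType d)
    (R : realType) (mu0 mu1 : probability Omega R) (n : nat)
    (V : 'I_n -> nat -> bool * n.-tuple Omega -> bool) (i : 'I_n) :
  voting_process mu0 mu1 V ->
  exists D, [/\ measurable D, forall x, V i 1%N x = (signal i x \in D) &
    forall B, measurable B ->
      fine (mu1 B) - fine (mu0 B) <= fine (mu1 D) - fine (mu0 D)].
Proof.
move=> hV; have [p cp vE] := hV i 1%N isT.
(* the condition 1 <= t' < 1 leaves no earlier vote among the generators *)
have GE : <<s information V i 1 >> = preimage_set_system setT (signal i) measurable.
  rewrite /information (_ : \bigcup_(_ in _) _ = set0) ?setU0.
    exact/sigma_algebra_id/sigma_algebra_preimage/sigma_algebra_measurable.
  by apply/seteqP; split => // A [[j t]]/=; case: t.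
have mS : measurable [set x : bool * n.-tuple Omega | state x] by exact: measurable_state.
have GM : <<s information V i 1 >> `<=` measurable.
  by rewrite GE => _ [B mB <-]; exact: measurable_signal.
have : <<s information V i 1 >> [set x | V i 1%N x].
  exact: (cond_prob_gt_half_measurable cp vE).
rewrite GE => -[D mD DE]; exists D.
have VE x : V i 1%N x = (signal i x \in D).
  have := congr1 (fun A : set _ => A x) DE; rewrite /= => h.
  apply/idP/idP => [Vx|/set_mem Dx]; first by apply/mem_set; move: Vx; rewrite -h => -[].
  by rewrite -h.
split => // B mB.
have mu : <<s information V i 1 >> [set x | signal i x \in B].
  rewrite GE; exists B => //.
  by apply/seteqP; split => x /=; rewrite in_setE => //; case.
have := bayes_decision_optimal GM mS cp vE mu.
have -> : [set x | V i 1%N x != state x] = [set x | (signal i x \in D) != state x].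
  by apply/seteqP; split => x /=; rewrite VE.
rewrite !signal_error// !probability_setC//.
rewrite -(fineK (fin_num_measure mu0 _ mD)) -(fineK (fin_num_measure mu1 _ mD)).
rewrite -(fineK (fin_num_measure mu0 _ mB)) -(fineK (fin_num_measure mu1 _ mB)).
rewrite -!EFinB -!EFinM -!EFinD lee_fin /=; lra.
Qed.

(** An observer who counts the signals falling in their events and compares the
count with the midpoint [theta] of its two conditional means errs only if the
count deviates from its mean by at least [n * delta / 2]. *)
Lemma threshold_error (d : measure_display) (Omega : measurableType d)
    (R : realType) (mu0 mu1 : probability Omega R) (n : nat)
    (D : 'I_n -> set Omega) (delta theta : R) :
  (forall i, measurable (D i)) -> 0 <= delta <= 1 ->
  (forall i, delta <= fine (mu1 (D i)) - fine (mu0 (D i))) ->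
  theta = (\sum_(i < n) fine (mu0 (D i)) + \sum_(i < n) fine (mu1 (D i))) / 2 ->
  (joint_law mu0 mu1 n
    [set x | (theta < \sum_(i < n) \1_(D i) (signal i x))%R != state x] <=
   (expR (- (delta ^+ 2 / 32 * n%:R)))%:E)%E.
Proof.
move=> mD /andP[d0 d1] dD.
set s0 := \sum_(i < n) fine (mu0 (D i)).
set s1 := \sum_(i < n) fine (mu1 (D i)) => thetaE.
have gap : n%:R * delta <= s1 - s0.
  rewrite -sumrB mulr_natl -[n in leLHS]card_ord -sumr_const.
  exact: ler_sum.
have ds : 0 <= delta / 2 <= 1 by lra.
have eE : delta ^+ 2 / 32 * n%:R = (delta / 2) ^+ 2 / 8 * n%:R by lra.
rewrite joint_lawE; last first.
  apply: measurable_disagreement; last exact: measurable_state.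
  apply: (@measurable_count_gt _ _ _ _ (fun i => signal i @^-1` D i)) => i.
  by rewrite -[X in measurable X]setTI; exact: measurable_signal.
have mge (A : 'I_n -> set Omega) (t : R) : (forall i, measurable (A i)) ->
    measurable [set w : n.-tuple Omega | t <= \sum_(i < n) \1_(A i) (tnth w i)].
  move=> mA.
  apply: (@measurable_count_ge _ _ R _ (fun i => [set w | A i (tnth w i)])) => i.
  exact: measurable_coordinate.
have mgt : measurable
    [set w : n.-tuple Omega | theta < \sum_(i < n) \1_(D i) (tnth w i)].
  apply: (@measurable_count_gt _ _ _ _ (fun i => [set w | D i (tnth w i)])) => i.
  exact: measurable_coordinate.
have t0 : (iid_law mu0 n [set w | (theta < \sum_(i < n) \1_(D i) (tnth w i))%R != false] <=
    (expR (- (delta ^+ 2 / 32 * n%:R)))%:E)%E.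
  have h : n%:R * (delta / 2) + s0 <= theta by rewrite thetaE; lra.
  apply: le_trans; last by rewrite eE; exact: (count_tail mD ds h).
  apply: le_measure; rewrite ?inE.
  - rewrite (_ : [set _ | _] = [set w | theta < \sum_(i < n) \1_(D i) (tnth w i)]).
      exact: mgt.
    by apply/seteqP; split => w /=; rewrite eqbF_neg negbK.
  - exact: mge mD.
  - by move=> w /=; rewrite eqbF_neg negbK => /ltW.
(* under mu1 an error means few hits, that is, many hits of the complements *)
have mDc i : measurable (~` D i) by exact: measurableC.
have t1 : (iid_law mu1 n [set w | (theta < \sum_(i < n) \1_(D i) (tnth w i))%R != true] <=
    (expR (- (delta ^+ 2 / 32 * n%:R)))%:E)%E.
  have sc : \sum_(i < n) fine (mu1 (~` D i)) = n%:R - s1.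
    rewrite -[n in n%:R]card_ord -sumr_const -sumrB; apply: eq_bigr => i _.
    rewrite probability_setC// -(fineK (fin_num_measure mu1 _ (mD i))).
    by rewrite -EFinB.
  have h : n%:R * (delta / 2) + \sum_(i < n) fine (mu1 (~` D i)) <= n%:R - theta.
    by rewrite sc thetaE; lra.
  apply: le_trans; last by rewrite eE; exact: (count_tail mDc ds h).
  apply: le_measure; rewrite ?inE.
  - rewrite (_ : [set _ | _] = ~` [set w | theta < \sum_(i < n) \1_(D i) (tnth w i)]).
      by apply: measurableC; exact: mgt.
    by apply/seteqP; split => w /=; rewrite eqb_id => /negP.
  - exact: mge mDc.
  - move=> w /=; rewrite eqb_id -leNgt => le_theta.
    rewrite (_ : \sum_(i < n) \1_(~` D i) (tnth w i) =
      n%:R - \sum_(i < n) \1_(D i) (tnth w i)); first by rewrite lerD2l lerN2.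
    rewrite -[n in n%:R]card_ord -sumr_const -sumrB; apply: eq_bigr => i _.
    by rewrite !indicE in_setC; case: (_ \in _); rewrite ?subr0 ?subrr.
rewrite [leRHS](_ : _ = ((2^-1)%:E * (expR (- (delta ^+ 2 / 32 * n%:R)))%:E +
   (2^-1)%:E * (expR (- (delta ^+ 2 / 32 * n%:R)))%:E)%E); last first.
  by rewrite -EFinM -EFinD; congr EFin; lra.
by apply: leeD; apply: lee_wpmul2l; rewrite ?lee_fin.
Qed.

(** * From one agent to all agents *)

Lemma union_bound (d : measure_display) (T : measurableType d)
    (R : realType) (P : probability T R) (n : nat) (A : 'I_n -> set T) (e : R) :
  (forall i, measurable (A i)) -> (forall i, (P (A i) <= e%:E)%E) ->
  (P (\big[setU/set0]_(i < n) A i) <= (n%:R * e)%:E)%E.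
Proof.
elim: n A => [|n IH] A mA leA; first by rewrite big_ord0 measure0 mul0r.
rewrite big_ord_recl; apply: (le_trans (measureU2 P _ _)) => //.
  exact: bigsetU_measurable.
rewrite addeC -natr1 mulrDl mul1r EFinD; apply: leeD; last exact: leA.
exact: IH.
Qed.

(** From [expR (y / 2) >= 1 + y / 2], squared, with [y = c * n]. *)
Lemma expR_dominates_id (R : realType) (c : R) (n : nat) :
  0 < c -> 4 / c ^+ 2 <= n%:R -> n%:R < expR (c * n%:R).
Proof.
move=> c0 hn.
have h2 : 4 <= c ^+ 2 * n%:R by rewrite mulrC -ler_pdivrMr// exprn_gt0.
have h : 1 + c * n%:R / 2 <= expR (c * n%:R / 2) by exact: expR_ge1Dx.
have n0 : (0 : R) <= n%:R by [].
have y0 : 0 <= c * n%:R by rewrite mulr_ge0// ltW.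
rewrite (_ : c * n%:R = c * n%:R / 2 + c * n%:R / 2); last lra.
rewrite expRD; apply: lt_le_trans (ler_pM _ _ h h); [|lra|lra].
set N : R := n%:R in h2 n0 y0 *.
have : 4 * N <= (c * N) ^+ 2 by rewrite exprMn expr2 mulrA; nra.
nra.
Qed.

Unset Implicit Arguments.
Set Strict Implicit.

Theorem theorem1p6 (R : realType) (d : measure_display)
    (Omega : measurableType d) (mu0 mu1 : probability Omega R)
    (hmu : signal_pair mu0 mu1) :
  exists (C : R) (n0 : nat), 0 < C /\
    forall n : nat, (n0 < n)%N ->
    forall V : 'I_n -> nat -> bool * n.-tuple Omega -> bool,
      voting_process mu0 mu1 V ->
      ((1 - expR (- (C * n%:R)))%:E <
         joint_law mu0 mu1 n [set x | forall i : 'I_n, V i 2%N x = state x])%E.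
Proof.
have [A mA ltA] := exists_separating_event hmu.
pose delta := fine (mu1 A) - fine (mu0 A).
have d0 : 0 < delta.
  by rewrite subr_gt0 -lte_fin !fineK ?fin_num_measure.
have d1 : delta <= 1.
  have : fine (mu1 A) <= 1.
    by rewrite -lee_fin fineK ?fin_num_measure//; exact: probability_le1.
  have : 0 <= fine (mu0 A) by exact: fine_ge0.
  by rewrite /delta; lra.
(* half of the rate delta ^+ 2 / 32 pays for the factor n of the union bound *)
pose C := delta ^+ 2 / 64.
have C0 : 0 < C by rewrite divr_gt0 ?exprn_gt0.
exists C, (Num.bound (4 / C ^+ 2)); split => // n ltn V hV.
have hn : 4 / C ^+ 2 <= n%:R.
  apply: (@le_trans _ _ (Num.bound (4 / C ^+ 2))%:R); last by rewrite ler_nat ltnW.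
  by apply/ltW/archi_boundP; rewrite divr_ge0 ?sqr_ge0.
have [D HD] := choice (fun i => first_vote_separates i hV).
have mD i : measurable (D i) by case: (HD i).
have VD i x : V i 1%N x = (signal i x \in D i) by case: (HD i) => _ ->.
have dD i : delta <= fine (mu1 (D i)) - fine (mu0 (D i)).
  by case: (HD i) => _ _; exact.
have d01 : 0 <= delta <= 1 by rewrite ltW.
pose theta : R :=
  (\sum_(i < n) fine (mu0 (D i)) + \sum_(i < n) fine (mu1 (D i))) / 2.
have err := threshold_error mD d01 dD (erefl theta).
pose P := joint_law mu0 mu1 n.
have mV1 j : measurable [set x | V j 1%N x].
  rewrite (_ : [set _ | _] = setT `&` signal j @^-1` (D j)).
    exact: measurable_signal.
  by apply/seteqP; split => x /=; rewrite VD in_setE => //; case.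
have sub i : <<s information V i 2 >> `<=` measurable.
  apply: smallest_sub; first exact: sigma_algebra_measurable.
  move=> E [[B mB <-]|[[j t] /= /andP[t1 t2]] [B mB <-]].
    exact: measurable_signal.
  have -> : t = 1%N by apply/eqP; rewrite eqn_leq t1 andbT.
  by apply: (measurable_fun_bool true) => //; rewrite setTI; exact: mV1.
have mS : measurable [set x : bool * n.-tuple Omega | state x] by exact: measurable_state.
have V2 i : measurable [set x | V i 2%N x] /\
    (P [set x | V i 2%N x != state x] <= (expR (- (delta ^+ 2 / 32 * n%:R)))%:E)%E.
  have [p cp vE] := hV i 2%N isT; split.
    by apply: (sub i); exact: (cond_prob_gt_half_measurable cp vE).
  apply: le_trans err.
  apply: (bayes_decision_optimal (sub i) mS cp vE).
  (* the threshold estimator is a function of the first votes, which i knows *)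
  pose X : measurableType _ := g_sigma_algebraType (information V i 2).
  apply: (@measurable_count_gt _ X _ _ (fun j => signal j @^-1` D j)) => j.
  apply: sub_sigma_algebra; right; exists (j, 1%N) => //.
  exists [set true] => //; rewrite setTI.
  by apply/seteqP; split => x /=; rewrite VD; [move/set_mem|move/mem_set].
pose bad := \big[setU/set0]_(i < n) [set x | V i 2%N x != state x].
have mE i : measurable [set x | V i 2%N x != state x].
  by apply: measurable_disagreement => //; case: (V2 i).
have mbad : measurable bad by exact: bigsetU_measurable.
have -> : [set x | forall i, V i 2%N x = state x] = ~` bad.
  rewrite /bad -bigcup_seq; apply/seteqP; split => x /=.
    by move=> Vx [i _]; rewrite /= Vx eqxx.
  move=> nbad i; apply/eqP; apply: contrapT => /negP Vx; apply: nbad.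
  by exists i => //=; exact: mem_index_enum.
rewrite [ltRHS](_ : _ = (1 - P bad)%E); last exact: (probability_setC P).
have ub : (P bad <= (n%:R * expR (- (delta ^+ 2 / 32 * n%:R)))%:E)%E.
  by apply: union_bound => // i; case: (V2 i).
rewrite -(fineK (fin_num_measure P _ mbad)) in ub *.
rewrite -EFinB lte_fin ltrD2l ltrN2; rewrite lee_fin in ub.
apply: le_lt_trans ub _.
rewrite (_ : delta ^+ 2 / 32 * n%:R = C * n%:R + C * n%:R); last first.
  by rewrite /C; lra.
rewrite opprD expRD mulrA -[ltRHS]mul1r ltr_pM2r ?expR_gt0//.
by rewrite expRN ltr_pdivrMr ?expR_gt0// mul1r; exact: expR_dominates_id.
Qed.
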